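(* No tournament on $8$ vertices is intrinsically knotted as a directed graph.
   Context: A tournament on $n$ vertices is a directed graph on $n$ vertices with exactly one directed edge between each pair of distinct vertices (equivalently, the complete graph $K_n$ with a choice of orientation of each edge). Embeddings are embeddings of the graph in $S^3$, in the usual (tame) sense of spatial graph theory. A cycle in a directed graph means a cycle of the underlying undirected graph; it is consistently oriented if its edges all point the same way around the cycle (i.e. it is a directed cycle). A directed graph $G$ is intrinsically knotted as a directed graph (digraph) if every embedding of $G$ in $S^3$ contains a consistently oriented cycle that is a non-trivial knot. *)

(* Defs.v *)
From HB Require Import structures.
From mathcomp Require Import all_boot all_order all_algebra.
From mathcomp Require Import all_classical all_reals all_analysis.
Import Order.TTheory GRing.Theory Num.Theory.
Import numFieldNormedType.Exports.

Set Implicit Arguments.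
Unset Strict Implicit.
Unset Printing Implicit Defensive.

Local Open Scope classical_set_scope.
Local Open Scope ring_scope.

Definition tournament (V : finType) (e : rel V) : Prop :=
  irreflexive e /\ forall x y : V, x != y -> e x y (+) e y x.

Definition S3 (R : realType) : set 'rV[R]_4 :=
  [set x | \sum_(i < 4) x ord0 i ^+ 2 = 1].

(* As [S3] is compact Hausdorff, every stage [H t], being a continuous
   bijection of [S3], is a homeomorphism of [S3]. *)
Record ambient_isotopy (R : realType) (H : R -> 'rV[R]_4 -> 'rV[R]_4) : Prop :=
  AmbientIsotopy {
    isotopy_continuous :
      {within `[0, 1]%classic `*` @S3 R, continuous (fun z => H z.1 z.2)};
    isotopy_bij : forall t, t \in `[0, 1] -> set_bij (@S3 R) (@S3 R) (H t);
    isotopy_start : forall x, S3 x -> H 0 x = x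
  }.

Definition ambient_isotopic (R : realType) (K L : set 'rV[R]_4) : Prop :=
  exists2 H : R -> 'rV[R]_4 -> 'rV[R]_4, ambient_isotopy H & H 1 @` K = L.

Definition unknot (R : realType) : set 'rV[R]_4 :=
  [set x | S3 x /\ forall i : 'I_4, (2 <= i)%N -> x ord0 i = 0].

Definition nontrivial_knot (R : realType) (K : set 'rV[R]_4) : Prop :=
  ~ ambient_isotopic K (@unknot R).

(* The trace on [S3] of the convex cone spanned by [a] and [b]: the shortest
   great-circle arc between [a / |a|] and [b / |b|]. In the degenerate cases
   ([a] and [b] linearly dependent) it consists of at most two points. *)
Definition great_arc (R : realType) (a b : 'rV[R]_4) : set 'rV[R]_4 :=
  [set x | S3 x /\ exists s t : R, [/\ 0 <= s, 0 <= t & x = s *: a + t *: b]].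

Definition polygonal (R : realType) (K : set 'rV[R]_4) : Prop :=
  exists s : seq ('rV[R]_4 * 'rV[R]_4),
    K = \bigcup_(ab in [set` s]) great_arc ab.1 ab.2.

Definition tame (R : realType) (K : set 'rV[R]_4) : Prop :=
  exists2 L : set 'rV[R]_4, polygonal L & ambient_isotopic K L.

(* [emb_edge x y], on the interval [0, 1], parametrizes the image of the edge
   from [x] to [y]; it is irrelevant when [e x y] does not hold. The graph being
   compact, an injective continuous map of it into [S3] is an embedding. *)
Record embedding (R : realType) (V : finType) (e : rel V) := Embedding {
  emb_vertex : V -> 'rV[R]_4;
  emb_edge : V -> V -> R -> 'rV[R]_4;
  emb_vertex_S3 : forall x, S3 (emb_vertex x);
  emb_edge_S3 : forall x y t, e x y -> t \in `[0, 1] -> S3 (emb_edge x y t);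
  emb_edge_continuous : forall x y, e x y ->
    {within `[0, 1]%classic, continuous (emb_edge x y)};
  emb_edge0 : forall x y, e x y -> emb_edge x y 0 = emb_vertex x;
  emb_edge1 : forall x y, e x y -> emb_edge x y 1 = emb_vertex y;
  emb_vertex_inj : injective emb_vertex;
  emb_edge_vertex : forall x y z t, e x y -> t \in `]0, 1[ ->
    emb_edge x y t <> emb_vertex z;
  emb_edge_inj : forall x y x' y' t t', e x y -> e x' y' ->
    t \in `]0, 1[ -> t' \in `]0, 1[ ->
    emb_edge x y t = emb_edge x' y' t' -> [/\ x = x', y = y' & t = t']
}.

Definition emb_image (R : realType) (V : finType) (e : rel V)
    (f : embedding R e) : set 'rV[R]_4 :=
  range (emb_vertex f) `|`
  \bigcup_(xy in [set xy : V * V | e xy.1 xy.2])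
    (emb_edge f xy.1 xy.2 @` `[0, 1]%classic).

(* A consistently oriented cycle is listed by its vertices in order, each one
   being joined by an edge of the digraph to the next one, cyclically. *)
Definition directed_cycle (V : finType) (e : rel V) (c : seq V) : bool :=
  [&& c != [::], cycle e c & uniq c].

Definition cycle_image (R : realType) (V : finType) (e : rel V)
    (f : embedding R e) (c : seq V) : set 'rV[R]_4 :=
  \bigcup_(x in [set` c]) (emb_edge f x (next c x) @` `[0, 1]%classic).

Definition intrinsically_knotted_digraph (R : realType) (V : finType)
    (e : rel V) : Prop :=
  forall f : embedding R e, tame (emb_image f) ->
    exists2 c : seq V, directed_cycle e c & nontrivial_knot (cycle_image f c).

(* Main.v *)
(**
  Place the eight vertices at the points t = 0, ..., 7 of the moment curve
  (t, t^2, t^3, 1) of R^4, seen radially in S^3, and join them by great arcs.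
  A vertex q of a polygon, with neighbors p and r, can be removed by an ambient
  isotopy as soon as no other edge meets the triangle pqr; for points on the
  moment curve an edge uw obstructs only if u and w alternate with p, q and r
  along the curve. All isotopies are shears x + phi(x) v of R^4 with phi
  positively homogeneous, followed by radial projection; a triangle is finally
  flattened onto a great circle.

  In this embedding of K_8 exactly 29 cycles fail to shrink to a triangle. A
  tournament on 8 vertices contains a transitive subtournament on 4 vertices;
  putting it at the positions 0 -> 4 -> 2 -> 6, all of these cycles but
  0 3 6 1 4 7 2 5 are inconsistent with its orientation. If this last cycle
  happens to be consistently oriented, exchanging the vertices at 3 and 5
  destroys it without affecting the transitive part.
*)
Require Import Defs.
From mathcomp Require Import all_boot all_order all_algebra.
From mathcomp Require Import all_classical all_reals all_analysis.
From mathcomp Require Import zify ring lra.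
Import Order.TTheory GRing.Theory Num.Theory.
Import numFieldNormedType.Exports.

Set Implicit Arguments.
Unset Strict Implicit.
Unset Printing Implicit Defensive.

(** ** Reducing polygons on the moment curve *)

Definition outside (u w x : nat) : bool :=
  ((x <= u) && (x <= w)) || ((u <= x) && (w <= x)).

(* On the moment curve a linear functional is a polynomial of degree at most 3
   in the parameter. The five alternatives say that one of [(t - u) (t - w)],
   [+-(t - u) (t - w)^2], [+-(t - w) (t - u)^2] is nonnegative at [p], [q] and
   [r], so that the edge [u w] meets the triangle [p q r] in at most one of the
   vertices [p], [r]. *)
Definition unobstructed (p q r u w : nat) : bool :=
  [&& q != u, q != w, ~~ ((p \in [:: u; w]) && (r \in [:: u; w])) &
   let T := [:: p; q; r] in
   [|| all (outside u w) T, all (leq u) T, all (geq u) T,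
       all (leq w) T | all (geq w) T]].

(** The path runs through all edges except [p q] and [q r], from [r] back to [p]. A triangle fails
    the test, since its third edge has both [p] and [r] as ends. *)
Definition removable (c : seq nat) : bool :=
  if c is p :: q :: r :: s then
    path (unobstructed p q r) r (rcons s p)
  else false.

(* [n] is fuel, spent both on removing vertices and on rotating the cycle. *)
Fixpoint shrinkable (n : nat) (c : seq nat) : bool :=
  if n is n'.+1 then
    if size c <= 3 then true else
    if removable c then shrinkable n' (head 0 c :: drop 2 c)
    else shrinkable n' (rot 1 c)
  else false.

(* A transitive subtournament sits at the positions [0 -> 4 -> 2 -> 6]. *)
Definition backward : seq (nat * nat) :=
  [:: (4, 0); (2, 0); (6, 0); (2, 4); (6, 4); (6, 2)].

Definition allowed (u w : nat) := (u, w) \notin backward.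

(* Up to orientation, the only cycle without a backward edge that does not
   shrink to a triangle. *)
Definition skip_cycle := [:: 0; 3; 6; 1; 4; 7; 2; 5].

Definition skip_cycle_rev := [:: 0; 5; 2; 7; 4; 1; 6; 3].

(** * Exhaustive search over the cycles on eight positions *)

Definition closing_ok (h : nat) (s : seq nat) : bool :=
  if (2 <= size s) && allowed (last h s) h then
    if shrinkable 64 (h :: s) then true
    else (h :: s == skip_cycle) || (h :: s == skip_cycle_rev)
  else true.

(** Depth-first search over cycles listed from their least vertex [h], so that later vertices are
    drawn from [h + 1, ..., 7]. The two directions of a cycle count as separate listings. *)
Fixpoint extensions_ok (n h : nat) (s : seq nat) : bool :=
  closing_ok h s &&
  (if n is n'.+1 then
     all (fun x => if (x \notin h :: s) && allowed (last h s) x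
                   then extensions_ok n' h (rcons s x) else true)
         (iota h.+1 (7 - h))
   else true).

Lemma all_extensions_ok : all (fun h => extensions_ok 7 h [::]) (iota 0 8).
Proof. by vm_compute. Qed.

(** By induction, the head of [t] moves onto the explored prefix [s]: it is one of the candidates
    that the search tries there. *)
Lemma extensions_okP n h s t : size t <= n -> extensions_ok n h s ->
  uniq (h :: s ++ t) -> all (fun x => h < x < 8) t ->
  path allowed (last h s) t -> closing_ok h (s ++ t).
Proof.
elim: n s t => [|n IHn] s [|x t] //=.
- by rewrite cats0 andbT => _ ->.
- by rewrite cats0 => _ /andP[].
move=> tn /andP[_ /allP ext] /andP[hst ust] /andP[/andP[hx x8] t8] /andP[lx xt].
rewrite -cat_rcons; apply: IHn => //; last 2 first.
- by rewrite /= cat_rcons hst.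
- by rewrite last_rcons.
have xs : x \notin h :: s.
  rewrite inE negb_or gtn_eqF//=; move: ust.
  by rewrite cat_uniq /= negb_or => /and3P[_ /andP[]].
have xi : x \in iota h.+1 (7 - h).
  rewrite mem_iota hx addSn subnKC//.
  by rewrite -ltnS; apply: leq_trans x8; rewrite ltnS ltnW.
by have := ext x xi; rewrite xs lx.
Qed.

Lemma shrinkable_cycle (E : rel nat) c :
  uniq c -> all (gtn 8) c -> 2 < size c -> cycle E c ->
  (forall u w, (u, w) \in backward -> ~~ E u w) ->
  ~~ cycle E skip_cycle -> ~~ cycle E skip_cycle_rev ->
  exists k, shrinkable 64 (rot k c).
Proof.
move=> uc c8 c3 Ec Eb E1 E2.
have exh : exists x, x \in c.
  by case: c c3 {uc c8 Ec} => [//|x c _]; exists x; rewrite mem_head.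
(* Rotating the cycle to its least vertex gives a listing that the search visits. *)
case: (ex_minnP exh) => h hc hmin; have [k s defc] := rot_to hc; exists k.
have c'8 : all (fun x => h <= x < 8) (h :: s).
  by apply/allP => x; rewrite -defc mem_rot => xc; rewrite hmin//=;
    exact: (allP c8).
move: uc Ec c3; rewrite -(rot_uniq k) -(rot_cycle k E) -(size_rot k c) defc.
move=> ucs Ecs s3.
have s8 : all (fun x => h < x < 8) s.
  apply/allP => x xs.
  have /andP[hx ->] := allP c'8 x (mem_behead (s := h :: s) xs).
  rewrite andbT ltn_neqAle hx andbT.
  by case/andP: ucs => hs _; apply: contraNneq hs => ->.
have sE : subrel E allowed.
  by move=> u w Euw; apply/negP => uw; case/negP: (Eb _ _ uw).
have Acs : cycle allowed (h :: s) := sub_path sE Ecs.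
have /andP[Apath Alast] : path allowed h s && allowed (last h s) h
  by rewrite -rcons_path.
have h8 : h \in iota 0 8 by rewrite mem_iota; case/andP: c'8 => /andP[_ ->].
have s7 : size s <= 7.
  apply: (uniq_leq_size ucs (s2 := iota 0 8)) => x xs.
  by rewrite mem_iota; case/andP: (allP c'8 x xs).
have := extensions_okP s7 (allP all_extensions_ok h h8) ucs s8 Apath.
rewrite /closing_ok [[::] ++ s]/= -[2 <= _]/(2 < size (h :: s)) s3 Alast /andb.
case: ifP => // _ /orP[] /eqP hs; move: Ecs; rewrite hs => Ecs.
- by case/negP: E1.
- by case/negP: E2.
Qed.

(** ** Labeling a tournament *)

Section TournamentLabeling.
Variables (V : finType) (e : rel V).
Hypothesis e_tour : tournament e.

Lemma tournament_irr x : e x x = false.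
Proof. by case: e_tour => irr _; exact: irr. Qed.

Lemma tournament_asym x y : e x y -> e y x = false.
Proof.
move=> xy; have [yx|yx] := eqVneq x y; first by rewrite -yx tournament_irr.
by case: e_tour => _ /(_ _ _ yx); rewrite xy => /negPf.
Qed.

Lemma tournament_total x y : x != y -> ~~ e x y -> e y x.
Proof. by move=> xy; case: e_tour => _ /(_ _ _ xy); case: (e x y). Qed.

(** In the inductive step, the out-neighbors [O] or the in-neighbors [I] of a vertex [x] make up at
    least half of the bound; [x] is put before a transitive part of [O] or after one of [I]. *)
Lemma transitive_subtournament k (A : seq V) : uniq A -> 2 ^ k <= size A ->
  exists s, [/\ size s = k.+1, {subset s <= A} & pairwise e s].
Proof.
elim: k A => [|k IHk] [|x A] //= uA szA.
- by exists [:: x]; split=> // y; rewrite !inE => ->.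
- by rewrite leqn0 expn_eq0 in szA.
case/andP: uA => xA uA.
pose O := [seq y <- A | e x y]; pose I := [seq y <- A | ~~ e x y].
have szOI : size O + size I = size A.
  by rewrite !size_filter -(count_predC (e x) A).
have [szO|szO] := leqP (2 ^ k) (size O).
  have [s [ss sO se]] := IHk O (filter_uniq _ uA) szO.
  exists (x :: s); split; first by rewrite /= ss.
    move=> y; rewrite !inE => /predU1P[->|/sO]; first by rewrite eqxx.
    by rewrite mem_filter => /andP[_ ->]; rewrite orbT.
  rewrite pairwise_cons se andbT; apply/allP => y /sO.
  by rewrite mem_filter => /andP[].
have szI : 2 ^ k <= size I by move: szA; rewrite expnS; lia.
have [s [ss sI se]] := IHk I (filter_uniq _ uA) szI.
exists (rcons s x); split; first by rewrite size_rcons ss.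
  move=> y; rewrite mem_rcons !inE => /predU1P[->|/sI]; first by rewrite eqxx.
  by rewrite mem_filter => /andP[_ ->]; rewrite orbT.
rewrite pairwise_rcons se andbT; apply/allP => y /sI.
rewrite mem_filter => /andP[/= xy yA]; apply: tournament_total xy.
by apply: contraNneq xA => ->.
Qed.

(* If the labeling [L1] makes the exceptional cycle consistently oriented, then
   [L2], which exchanges the labels 3 and 5, does not. *)
Lemma tournament_labeling : #|V| = 8 -> exists (lab : V -> nat) (E : rel nat),
  [/\ injective lab, forall x, lab x < 8
    & forall x y, e x y = E (lab x) (lab y)] /\
  [/\ forall u w, (u, w) \in backward -> ~~ E u w,
      ~~ cycle E skip_cycle & ~~ cycle E skip_cycle_rev].
Proof.
move=> V8; have V8' : size (enum V) = 8 by rewrite -cardE.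
have [|s [s4 _ se]] := @transitive_subtournament 3 _ (enum_uniq V);
  first by rewrite V8'.
have us : uniq s.
  rewrite uniq_pairwise; apply: sub_pairwise se => x y xy /=.
  by apply: contraTneq xy => ->; rewrite tournament_irr.
pose B := [seq x <- enum V | x \notin s].
have sB : perm_eq (s ++ B) (enum V).
  apply: uniq_perm; rewrite ?enum_uniq//.
    rewrite cat_uniq us filter_uniq ?enum_uniq// andbT; apply/hasPn => x.
    by rewrite mem_filter => /andP[].
  by move=> x; rewrite mem_cat mem_filter mem_enum /= andbT orbN.
have B4 : size B = 4.
  by have := perm_size sB; rewrite size_cat s4 V8' => -[].
case: B sB B4 => [//|w [//|x [//|y [//|z [|//]]]]] sB _.
case: s s4 us se sB => [//|a [//|b [//|c [//|d [|//]]]]] _ us.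
rewrite /= !andbT => /and3P[/and3P[ab ac ad] /andP[bc bd] cd].
move=> sB.
suff [L pL [Eb E1 E2]] : exists2 L, perm_eq L (enum V) &
    let E i j := e (nth a L i) (nth a L j) in
    [/\ forall u w, (u, w) \in backward -> ~~ E u w,
        ~~ cycle E skip_cycle & ~~ cycle E skip_cycle_rev].
  have Lall v : v \in L by rewrite (perm_mem pL) mem_enum.
  exists (index^~ L), (fun i j => e (nth a L i) (nth a L j)).
  split=> //; split=> [u v uv|v|u v].
  - by rewrite -(nth_index a (Lall u)) uv nth_index.
  - by have := Lall v; rewrite -index_mem (perm_size pL) V8'.
  - by rewrite !nth_index.
(* The positions 0, 4, 2, 6 receive [a], [b], [c], [d] in transitive order. *)
pose L1 := [:: a; w; c; x; b; y; d; z].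
pose L2 := [:: a; w; c; y; b; x; d; z].
have [p1 p2] : perm_eq L1 (enum V) /\ perm_eq L2 (enum V).
  split; apply: perm_trans sB; apply/permP => P /=;
  move: (P a : nat) (P b : nat) (P c : nat) (P d : nat) (P w : nat);
  move: (P x : nat) (P y : nat) (P z : nat); lia.
have back L : L = L1 \/ L = L2 ->
    forall u w, (u, w) \in backward -> ~~ e (nth a L u) (nth a L w).
  move=> LE u v; suff /allP bA :
      all (fun i => ~~ e (nth a L i.1) (nth a L i.2)) backward.
    exact: (bA (u, v)).
  by case: LE => ->; rewrite /= !(tournament_asym ab, tournament_asym ac,
    tournament_asym ad, tournament_asym bc, tournament_asym bd,
    tournament_asym cd).
pose E1 i j := e (nth a L1 i) (nth a L1 j).
(* Under [L1] the cycle uses [y -> a] and [z -> c]; under [L2] it would need [a -> y], and its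
   reverse [c -> z]. In the case [C2] the conflicting edges are [x -> a] and [w -> d]. *)
have [C1|C1] := boolP (cycle E1 skip_cycle).
  exists L2 => //; split; first by apply: back; right.
    case/and5P: C1 => _ _ _ _ /and5P[_ _ _ ya _].
    by rewrite /= (tournament_asym ya) ?andbF.
  case/and5P: C1 => _ _ _ _ /and5P[_ zc _ _ _].
  by rewrite /= (tournament_asym zc) ?andbF.
have [C2|C2] := boolP (cycle E1 skip_cycle_rev).
  exists L2 => //; split; first by apply: back; right.
    case/and5P: C2 => _ _ _ _ /and5P[_ wd _ _ _].
    by rewrite /= (tournament_asym wd) ?andbF.
  case/and5P: C2 => _ _ _ _ /and5P[_ _ _ xa _].
  by rewrite /= (tournament_asym xa) ?andbF.
by exists L1 => //; split=> //; apply: back; left.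
Qed.

End TournamentLabeling.

Local Open Scope classical_set_scope.
Local Open Scope ring_scope.

(** ** Ambient isotopies by shears *)

Lemma within_continuous_comp2 {U V W : topologicalType} (A : set U) (B : set V)
    (f : U -> V) (g : V -> W) :
  A `<=` f @^-1` B -> {within A, continuous f} -> {within B, continuous g} ->
  {within A, continuous (g \o f)}.
Proof.
move=> AB /subspace_continuousP cf /subspace_continuousP cg.
apply/subspace_continuousP => z Az.
apply: cvg_comp (cg _ (AB z Az)) => D /(cf z Az) /=.
rewrite /within /= !nbhs_simpl /=.
by apply: filterS => x + Ax => /(_ Ax); apply; exact: AB.
Qed.

Section Isotopy.
Variable R : realType.
Implicit Types (x y v : 'rV[R]_4) (C K L : set 'rV[R]_4).

(** The Euclidean norm, as opposed to the sup norm of ['rV[R]_4]. *)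
Definition norm2 x : R := Num.sqrt (\sum_(i < 4) x ord0 i ^+ 2).

Definition radial x : 'rV[R]_4 := (norm2 x)^-1 *: x.

Lemma sumsq_ge0 x : 0 <= \sum_(i < 4) x ord0 i ^+ 2.
Proof. by apply: sumr_ge0 => i _; exact: sqr_ge0. Qed.

Lemma norm2_gt0 x : x != 0 -> 0 < norm2 x.
Proof.
move=> x0; rewrite sqrtr_gt0 lt0r sumsq_ge0 andbT.
apply: contra x0; rewrite psumr_eq0; last by move=> i _; exact: sqr_ge0.
move=> /allP x0; apply/eqP/rowP => i; rewrite mxE.
by have := x0 i (mem_index_enum i); rewrite /= sqrf_eq0 => /eqP.
Qed.

Lemma norm2Z k x : 0 <= k -> norm2 (k *: x) = k * norm2 x.
Proof.
move=> k0; rewrite /norm2; under eq_bigr do rewrite mxE exprMn.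
by rewrite -mulr_sumr sqrtrM ?sqr_ge0// sqrtr_sqr ger0_norm.
Qed.

Lemma S3E x : S3 x <-> norm2 x = 1.
Proof.
rewrite /S3 /norm2 /=; split=> [->|/(congr1 (fun r => r ^+ 2))].
  by rewrite sqrtr1.
by rewrite sqr_sqrtr ?sumsq_ge0// expr1n.
Qed.

Lemma S3_neq0 x : S3 x -> x != 0.
Proof.
move=> /S3E x1; apply/eqP => x0; move: x1; rewrite x0 -(scale0r 0) norm2Z//.
by rewrite mul0r => /esym/eqP; rewrite oner_eq0.
Qed.

Lemma radialZ k x : 0 < k -> radial (k *: x) = radial x.
Proof.
move=> k0; rewrite /radial norm2Z ?ltW// invfM scalerA mulrAC.
by rewrite mulVf ?mul1r// gt_eqF.
Qed.

Lemma radial_S3 x : x != 0 -> S3 (radial x).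
Proof.
move=> x0; have := norm2_gt0 x0 => n0; apply/S3E.
by rewrite norm2Z ?invr_ge0 ?ltW// mulVf// gt_eqF.
Qed.

Lemma radial_id x : S3 x -> radial x = x.
Proof. by move=> /S3E x1; rewrite /radial x1 invr1 scale1r. Qed.

Lemma radial_eq x y : x != 0 -> y != 0 -> radial x = radial y ->
  exists2 k, 0 < k & x = k *: y.
Proof.
move=> /norm2_gt0 x0 /norm2_gt0 y0 xy; exists (norm2 x / norm2 y).
  exact: divr_gt0.
rewrite -scalerA -/(radial y) -xy /radial scalerA divff ?scale1r//.
by rewrite gt_eqF.
Qed.

Lemma norm2_continuous : continuous norm2.
Proof.
move=> x; apply: (@continuous_comp _ _ _
  (fun x : 'rV[R]_4 => \sum_(i < 4) x ord0 i ^+ 2) Num.sqrt); last first.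
  exact: sqrt_continuous.
have -> : (fun x : 'rV[R]_4 => \sum_(i < 4) x ord0 i ^+ 2) =
    \sum_(i < 4) (fun x : 'rV[R]_4 => x ord0 i ^+ 2).
  by rewrite fct_sumE.
apply: (big_ind (fun f : 'rV[R]_4 -> R => {for x, continuous f})).
- exact: cst_continuous.
- by move=> f g; exact: continuousD.
- move=> i _; apply: (@continuousM _ _ (fun x : 'rV[R]_4 => x ord0 i)
    (fun x : 'rV[R]_4 => x ord0 i)); exact: coord_continuous.
Qed.

Lemma radial_continuous x : x != 0 -> {for x, continuous radial}.
Proof.
move=> x0; apply: (@continuousZ _ _ _ (fun x => (norm2 x)^-1) id) => //.
by apply: continuousV; [rewrite gt_eqF// norm2_gt0|exact: norm2_continuous].
Qed.

Lemma ambient_isotopic_refl K : ambient_isotopic K K.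
Proof.
exists (fun _ x => x); last exact: image_id.
split=> // [|t _].
  by apply: continuous_subspaceT => z; exact: cvg_snd.
by split=> // x x3; exists x.
Qed.

(** The isotopies are composed stage by stage instead of being run one after the other, so no gluing
    in time occurs. *)
Lemma ambient_isotopic_trans K L M :
  ambient_isotopic K L -> ambient_isotopic L M -> ambient_isotopic K M.
Proof.
move=> [G [Gc Gb G0] <-] [H [Hc Hb H0] <-].
exists (fun t x => H t (G t x)); last by rewrite image_comp.
split=> [|t t01|x x3].
- apply: (@within_continuous_comp2 _ _ _ _ _ (fun z => (z.1, G z.1 z.2))
    (fun z => H z.1 z.2) _ _ Hc).
    case=> t x [/= t01 x3]; split=> //=.
    by case: (Gb t t01) => Gf _ _; exact: Gf.
  have /subspace_continuousP Gc' := Gc.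
  apply/subspace_continuousP => z Az.
  apply: (@cvg_pair _ _ _ _ (nbhs z.1) (nbhs (G z.1 z.2))); last exact: Gc'.
  move=> D D1; suff : nbhs z [set y | D y.1] by apply: filterS.
  by case: z D1 {Az} => t x D1; exact: cvg_fst.
- exact: set_bij_comp (Gb t t01) (Hb t t01).
- by rewrite G0 // H0.
Qed.

End Isotopy.

(** * Positively homogeneous shears of R^4 *)

Section Shear.
Variables (R : realType) (phi : 'rV[R]_4 -> R) (v : 'rV[R]_4) (kappa : R).
Hypothesis phi_continuous : continuous phi.
Hypothesis phiZ : forall k x, 0 <= k -> phi (k *: x) = k * phi x.
Hypothesis kappa01 : 0 <= kappa < 1.
(* On each line parallel to [v], [shear t] is strictly increasing in the
   direction of [v]. *)
Hypothesis phi_lip : forall x s, 0 <= s ->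
  phi x - phi (x + s *: v) <= kappa * s.
Implicit Types (x y : 'rV[R]_4) (t : R).

Definition shear t x : 'rV[R]_4 := x + (t * phi x) *: v.

Lemma shearZ t k x : 0 <= k -> shear t (k *: x) = k *: shear t x.
Proof. by move=> k0; rewrite /shear phiZ// scalerDr scalerA mulrCA. Qed.

(** Points with the same image differ by [s *: v], where [s] is the difference of their shifts; the
    slope bound gives [s <= kappa * s], hence [s = 0]. *)
Lemma shear_inj t : 0 <= t <= 1 -> injective (shear t).
Proof.
move=> /andP[t0 t1]; suff H x y : t * phi x <= t * phi y ->
    shear t x = shear t y -> x = y.
  move=> x y xy; have [/H|/ltW/H] := leP (t * phi x) (t * phi y); first exact.
  by move=> /(_ (esym xy)).
rewrite /shear => le_xy /(canRL (addrK _)); rewrite -addrA -scalerBl => xE.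
have s0 : 0 <= t * phi y - t * phi x by rewrite subr_ge0.
have := phi_lip y s0.
rewrite -xE; set s := t * phi y - t * phi x in s0 xE * => yx.
have /andP[k0 k1] := kappa01.
have tyx : s = t * (phi y - phi x) by rewrite mulrBr.
have s_le : s <= t * (kappa * s) by rewrite {1}tyx ler_wpM2l.
suff s00 : s = 0 by rewrite xE s00 scale0r addr0.
have ks : t * (kappa * s) <= kappa * s by rewrite ler_piMl// mulr_ge0.
by apply/eqP; rewrite eq_le s0 andbT leNgt; apply/negP => s_gt0; nra.
Qed.

(** A preimage is sought on the line through [y] parallel to [v], as a zero of [F], by the
    intermediate value theorem. *)
Lemma shear_surj t y : 0 <= t <= 1 -> exists x, shear t x = y.
Proof.
move=> /andP[t0 t1]; have /andP[k0 k1] := kappa01.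
pose F s := s - t * phi (y - s *: v).
(* Chosen so that [|phi y| + kappa * S = S], which bounds the shift at both ends of the interval
   from [-S] to [S]. *)
pose S := `|phi y| / (1 - kappa).
have S0 : 0 <= S by rewrite divr_ge0// subr_ge0 ltW.
have SE : (1 - kappa) * S = `|phi y|.
  by rewrite mulrC divfK// subr_eq0 gt_eqF.
have Fc : continuous F.
  move=> s.
  apply: (@continuousB R R^o R id (fun s => t * phi (y - s *: v))) => //.
  apply: (@continuousM _ _ (fun=> t)); first exact: cst_continuous.
  apply: continuous_comp; last exact: phi_continuous.
  apply: (@continuousB R 'rV[R]_4 R (fun=> y) (fun s : R => s *: v)).
    exact: cst_continuous.
  apply: (@continuousZ _ _ _ id (fun=> v)) => //; exact: cst_continuous.
have FS : 0 <= F S.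
  have := phi_lip (y - S *: v) S0; rewrite subrK /F.
  have := ler_norm (phi y); nra.
have FNS : F (- S) <= 0.
  have := phi_lip y S0; rewrite /F scaleNr opprK.
  have := ler_norm (- phi y); rewrite normrN; nra.
have [|||s _ Fs] := @IVT _ F (- S) S 0; first by lra.
- exact: continuous_subspaceT.
- by rewrite ge_min FNS le_max FS orbT.
have tP : t * phi (y - s *: v) = s.
  by move: Fs; rewrite /F => /eqP; rewrite subr_eq0 => /eqP.
by exists (y - s *: v); rewrite /shear tP subrK.
Qed.

Lemma shear0 t : shear t 0 = 0.
Proof. by have := shearZ t 0 (lexx 0); rewrite !scale0r. Qed.

Lemma shear_neq0 t x : 0 <= t <= 1 -> x != 0 -> shear t x != 0.
Proof.
by move=> t01; apply: contra => /eqP x0; apply/eqP/(shear_inj t01);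
  rewrite x0 shear0.
Qed.

(** By homogeneity [shear t] permutes the open rays from the origin, and the sphere meets each ray
    exactly once. *)
Lemma shear_isotopy : ambient_isotopy (fun t x => radial (shear t x)).
Proof.
split=> [|t /[!in_itv]/= t01|x x3]; last first.
- by rewrite /shear mul0r scale0r addr0 radial_id.
- split=> [x /S3_neq0 x0|x y /[!inE] x3 y3|y y3].
  + by apply: radial_S3; exact: shear_neq0.
  + move=> /radial_eq[||k k0]; rewrite ?shear_neq0 ?S3_neq0//.
    rewrite -shearZ ?ltW// => /(shear_inj t01) xE; move: x3 y3.
    rewrite xE => /S3E; rewrite norm2Z ?ltW// => k1 /S3E y1.
    by move: k1; rewrite y1 mulr1 => ->; rewrite scale1r.
  + have [x xy] := shear_surj y t01.
    have x0 : x != 0.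
      by apply: contra (S3_neq0 y3) => /eqP x0; rewrite -xy x0 shear0.
    exists (radial x); first exact: radial_S3.
    rewrite [radial x]/radial shearZ ?invr_ge0 ?sqrtr_ge0// radialZ.
      by rewrite xy radial_id.
    by rewrite invr_gt0 norm2_gt0.
apply: continuous_in_subspaceT => -[t x]; rewrite inE => -[/= t01 x3].
rewrite in_itv/= in t01.
apply: (@continuous_comp _ _ _ (fun z : R * 'rV[R]_4 => shear z.1 z.2)
  (@radial R)).
  apply: (@continuousD _ _ _ snd
    (fun z : R * 'rV[R]_4 => (z.1 * phi z.2) *: v)).
    exact: cvg_snd.
  apply: (@continuousZ _ _ _ (fun z : R * 'rV[R]_4 => z.1 * phi z.2) (fun=> v)).
    apply: (@continuousM _ _ fst (phi \o snd)); first exact: cvg_fst.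
    by apply: continuous_comp; [exact: cvg_snd|exact: phi_continuous].
  exact: cst_continuous.
by apply: radial_continuous; apply: shear_neq0 => //; exact: S3_neq0.
Qed.

(** For sets invariant under positive scaling the radial projection can be forgotten: it suffices to
    compute the image of the cone. *)
Lemma shear_isotopic (C : set 'rV[R]_4) :
  (forall k x, 0 < k -> C x -> C (k *: x)) ->
  ambient_isotopic (@S3 R `&` C) (@S3 R `&` ((fun x => x + phi x *: v) @` C)).
Proof.
move=> CZ; exists (fun t x => radial (shear t x)); first exact: shear_isotopy.
have t1 : 0 <= (1 : R) <= 1 by rewrite ler01 lexx.
have E x : x + phi x *: v = shear 1 x by rewrite /shear mul1r.
apply/seteqP; split=> [_ [x [x3 Cx] <-]|y [y3 [x Cx yE]]].
  have x0 : x != 0 := S3_neq0 x3; split.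
    by apply: radial_S3; exact: shear_neq0.
  have n0 : 0 < (norm2 (shear 1 x))^-1.
    by rewrite invr_gt0 norm2_gt0 ?shear_neq0.
  exists ((norm2 (shear 1 x))^-1 *: x); first exact: CZ.
  by rewrite E shearZ ?ltW.
rewrite E in yE; rewrite -yE in y3 *.
have x0 : x != 0.
  by apply: contra (S3_neq0 y3) => /eqP ->; rewrite shear0.
exists (radial x).
  split; first exact: radial_S3.
  by apply: CZ => //; rewrite invr_gt0 norm2_gt0.
rewrite [radial x]/radial shearZ ?invr_ge0 ?sqrtr_ge0// radialZ ?radial_id//.
by rewrite invr_gt0 norm2_gt0.
Qed.

End Shear.

(** ** The triangle move *)

Section BumpFunction.
Variable R : realType.
Implicit Types (a b c w k s D : R).

(* In coordinates [(a, b, c, w)] with respect to a basis [p, q, r, d], the path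
   [p q r] is the graph [b = min (a + b) (c + b)], [w = 0] over the quantities
   [a + b], [c + b], [w], which are invariant under translation by [p - q + r].
   The bump equals [b] there, is supported in a conical neighborhood of the
   triangle [p q r] of width [D], and has slope less than 1 in [b]. *)
Definition bump D a b c w : R :=
  Num.max 0 (Num.min ((b + D * Num.min (a + b) (c + b)) / (1 + D))
                     (((1 + D) * Num.min (a + b) (c + b) - b) / D) - `|w| / D).

Lemma bumpZ D k a b c w : 0 <= k ->
  bump D (k * a) (k * b) (k * c) (k * w) = k * bump D a b c w.
Proof.
move=> k0; rewrite /bump -!mulrDr -(minr_pMr (a + b) (c + b) k0).
rewrite normrM (ger0_norm k0).
set g := Num.min (a + b) (c + b).
rewrite maxr_pMr// mulr0; congr (Num.max _ _).
rewrite mulrBr -[k * `|w| / D]mulrA; congr (_ - _).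
rewrite [RHS]minr_pMr//; congr (Order.min _ _).
  by rewrite [RHS]mulrA; congr (_ / _); ring.
by rewrite [RHS]mulrA; congr (_ / _); ring.
Qed.

(** Only the first argument of the inner minimum decreases, with slope [(1 + D)^-1]; the second one
    increases. *)
Lemma bump_lip D a b c w s : 0 < D -> 0 <= s ->
  bump D a b c w - bump D (a + s) (b - s) (c + s) w <= (1 + D)^-1 * s.
Proof.
move=> D0 s0; rewrite /bump.
have -> : a + s + (b - s) = a + b by ring.
have -> : c + s + (b - s) = c + b by ring.
set g := Num.min (a + b) (c + b).
have k0 : 0 <= (1 + D)^-1 * s by rewrite mulr_ge0// invr_ge0 addr_ge0// ltW.
have i0 : 0 <= s / D by rewrite divr_ge0// ltW.
have -> : (b - s + D * g) / (1 + D) = (b + D * g) / (1 + D) - (1 + D)^-1 * s.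
  by rewrite (mulrC _^-1 s) -mulrBl; congr (_ / _); ring.
have -> : ((1 + D) * g - (b - s)) / D = ((1 + D) * g - b) / D + s / D.
  by rewrite -mulrDl; congr (_ / _); ring.
move: k0 i0; move: (_ * s) (s / D) (_ / (1 + D)) (_ / D) (`|w| / D) =>
  m i A1 A2 W.
by move=> m0 i0; rewrite /Num.max /Num.min; do !case: ifP; lra.
Qed.

Lemma bump_left D a b : 0 < D -> 0 <= a -> 0 <= b -> bump D a b 0 0 = b.
Proof.
move=> D0 a0 b0; rewrite /bump add0r.
have -> : Num.min (a + b) b = b by rewrite min_r ?lerDr.
rewrite normr0 mul0r subr0.
have -> : (b + D * b) / (1 + D) = b.
  by field; rewrite gt_eqF// addr_gt0.
have -> : ((1 + D) * b - b) / D = b.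
  by field; rewrite gt_eqF.
by rewrite minxx max_r.
Qed.

Lemma bump_sym D a b c w : bump D a b c w = bump D c b a w.
Proof. by rewrite /bump (minC (a + b)). Qed.

(** Where the bump is positive, [a], [b], [c] exceed [- D * g], [|w| < D * g] and [a + b >= g > 0].
    The functional with values [lp], [lq], [lr], [ld] on the frame then exceeds
    [mu * g - D * S * g], which is nonnegative for [D <= mu / S]. *)
Lemma bump_separated_left lp lq lr ld : 0 < lp -> 0 < lq -> 0 <= lr ->
  exists2 D0 : R, 0 < D0 & forall D a b c w, 0 < D <= D0 ->
    a * lp + b * lq + c * lr + w * ld <= 0 -> bump D a b c w = 0.
Proof.
move=> lp0 lq0 lr0; pose mu := Num.min lp lq.
have mu0 : 0 < mu by rewrite lt_min lp0.
have [mup muq] : mu <= lp /\ mu <= lq by rewrite /mu !ge_min !lexx orbT.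
pose S := lp + lq + lr + `|ld|.
have S0 : 0 < S by have := normr_ge0 ld; rewrite /S; lra.
exists (mu / S); first by rewrite divr_gt0.
move=> D a b c w /andP[D0]; rewrite ler_pdivlMr// => DS l0.
rewrite /bump; set g := Num.min (a + b) (c + b).
have [g_ab g_cb] : g <= a + b /\ g <= c + b by rewrite /g !ge_min !lexx orbT.
apply/max_l; rewrite subr_le0 leNgt lt_min; apply/negP => /andP[].
rewrite ltr_pdivlMr// ?addr_gt0// ltr_pdivlMr// divfK ?gt_eqF// => W1 W2.
have W0 := normr_ge0 w.
have W3 : `|w| < D * g.
  move: W1; rewrite mulrDr mulr1 divfK ?gt_eqF// -(ltr_pM2r D0) mulrDl.
  by rewrite divfK ?gt_eqF//; nra.
have g0 : 0 < g by rewrite -(pmulr_rgt0 _ D0); lra.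
have Wd : `|w| * `|ld| <= D * g * `|ld| by rewrite ler_wpM2r// ltW.
have wd : - (`|w| * `|ld|) <= w * ld by rewrite -normrM lerNl -normrN ler_norm.
have Dw : 0 <= `|w| / D by rewrite divr_ge0// ltW.
have b1 : 0 < b + D * g by move: W1; rewrite mulrDr mulr1; nra.
have a1 : 0 < a + D * g by lra.
have c1 : 0 < c + D * g by lra.
have := ler_wpM2l (ltW a1) mup; have := ler_wpM2l (ltW b1) muq.
have := mulr_ge0 (ltW c1) lr0.
have : D * S * g <= mu * g by rewrite ler_wpM2r// ltW.
have : 0 < mu * (D * g) by rewrite !mulr_gt0.
have : mu * g <= mu * (a + b) by rewrite ler_wpM2l// ltW.
rewrite /S; move: wd Wd l0; move: (w * ld) (`|w| * _) => m1 m2; lra.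
Qed.

(** One of [lp], [lr] is positive, and the bump is symmetric in the two. *)
Lemma bump_separated lp lq lr ld :
  0 <= lp -> 0 < lq -> 0 <= lr -> 0 < lp + lr ->
  exists2 D0 : R, 0 < D0 & forall D a b c w, 0 < D <= D0 ->
    a * lp + b * lq + c * lr + w * ld <= 0 -> bump D a b c w = 0.
Proof.
move=> lp0 lq0 lr0 lpr; have [lp1|lp1] := ltP 0 lp.
  exact: bump_separated_left.
have [|D0 D00 DP] := @bump_separated_left lr lq lp ld _ lq0 lp0; first by lra.
exists D0 => // D a b c w DD0 l0; rewrite bump_sym; apply: DP => //; lra.
Qed.

End BumpFunction.

(** * Moves in the coordinates of a frame *)

Section Frames.
Variable R : realType.
Local Notation V := 'rV[R]_4.

Definition cone2 (a b : V) : set V :=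
  [set x | exists s t : R, [/\ 0 <= s, 0 <= t & x = s *: a + t *: b]].

Lemma great_arcE (a b : V) : great_arc a b = @S3 R `&` cone2 a b.
Proof. by []. Qed.

Lemma cone2Z (a b : V) k x : 0 < k -> cone2 a b x -> cone2 a b (k *: x).
Proof.
move=> k0 [s [t [s0 t0 ->]]]; exists (k * s), (k * t).
by rewrite !mulr_ge0 ?(ltW k0)// scalerDr !scalerA.
Qed.

Definition frame (p q r d : V) : 'M[R]_4 :=
  \matrix_(i < 4) nth 0 [:: p; q; r; d] i.

Variables p q r d : V.
Hypothesis frame_unit : frame p q r d \in unitmx.

Definition coord_in (i : 'I_4) (x : V) : R :=
  (x *m invmx (frame p q r d)) ord0 i.

Definition alpha := coord_in (inord 0).
Definition beta := coord_in (inord 1).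
Definition gamma := coord_in (inord 2).
Definition omega := coord_in (inord 3).

Lemma coord_in_lin i k x y :
  coord_in i (k *: x + y) = k * coord_in i x + coord_in i y.
Proof. by rewrite /coord_in mulmxDl -scalemxAl !mxE. Qed.

Lemma coord_in_continuous i : continuous (coord_in i).
Proof.
have -> : coord_in i =
    \sum_j (fun x : V => x ord0 j * invmx (frame p q r d) j i).
  by rewrite fct_sumE; apply/funext => x; rewrite /coord_in mxE.
move=> x; apply: (big_ind (fun f : V -> R => {for x, continuous f})).
- exact: cst_continuous.
- by move=> f g; exact: continuousD.
- move=> j _; apply: (@continuousM _ _ (fun x : V => x ord0 j) (fun=> _)).
    exact: coord_continuous.
  exact: cst_continuous.
Qed.

Lemma frame_decomp x :
  x = alpha x *: p + beta x *: q + gamma x *: r + omega x *: d.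
Proof.
rewrite -{1}(mulmx1 x) -(mulVmx frame_unit) mulmxA mulmx_sum_row.
rewrite 4!big_ord_recl big_ord0 addr0 !rowK /= !addrA.
rewrite /alpha /beta /gamma /omega /coord_in.
by congr (_ *: _ + _ *: _ + _ *: _ + _ *: _); congr (_ _ _);
  apply/val_inj; rewrite /= inordK.
Qed.

Lemma coord_in_row i (j : 'I_4) :
  coord_in i (nth 0 [:: p; q; r; d] j) = (j == i)%:R.
Proof.
have -> : nth 0 [:: p; q; r; d] j = row j (frame p q r d) by rewrite rowK.
by rewrite /coord_in -row_mul mulmxV// !mxE.
Qed.

Lemma coord_in_comb a b c w i :
  coord_in i (a *: p + b *: q + c *: r + w *: d) = nth 0 [:: a; b; c; w] i.
Proof.
rewrite -(addr0 (_ + w *: d)) -!addrA !coord_in_lin.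
have -> : coord_in i 0 = 0.
  by rewrite /coord_in mul0mx mxE.
have := coord_in_row i (inord 0); have := coord_in_row i (inord 1).
have := coord_in_row i (inord 2); have := coord_in_row i (inord 3).
rewrite !inordK//= => -> -> -> ->; rewrite -!val_eqE /= !inordK//.
by case: i => -[|[|[|[|//]]]] /= _; rewrite !(mulr1, mulr0, addr0, add0r).
Qed.

Lemma coord_comb a b c w : let x := a *: p + b *: q + c *: r + w *: d in
  [/\ alpha x = a, beta x = b, gamma x = c & omega x = w].
Proof. by rewrite /alpha /beta /gamma /omega !coord_in_comb !inordK. Qed.

Definition push (D : R) (x : V) : R :=
  bump D (alpha x) (beta x) (gamma x) (omega x).

Lemma coord_shift x s :
  [/\ alpha (x + s *: (p - q + r)) = alpha x + s,
      beta (x + s *: (p - q + r)) = beta x - s,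
      gamma (x + s *: (p - q + r)) = gamma x + s
    & omega (x + s *: (p - q + r)) = omega x].
Proof.
have := coord_comb (alpha x + s) (beta x - s) (gamma x + s) (omega x) => /=.
suff -> : (alpha x + s) *: p + (beta x - s) *: q + (gamma x + s) *: r +
  omega x *: d = x + s *: (p - q + r) by [].
rewrite [in RHS](frame_decomp x).
move: (alpha x) (beta x) (gamma x) (omega x) => a b c w.
by apply/rowP => i; rewrite !mxE; ring.
Qed.

Lemma push_continuous D : continuous (push D).
Proof.
move=> x.
have c0 k : {for x, continuous ((fun=> k) : V -> R^o)} by exact: cst_continuous.
have ca : {for x, continuous (alpha : V -> R^o)} by exact: coord_in_continuous.
have cb : {for x, continuous (beta : V -> R^o)} by exact: coord_in_continuous.
have cc : {for x, continuous (gamma : V -> R^o)} by exact: coord_in_continuous.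
have cw : {for x, continuous (omega : V -> R^o)} by exact: coord_in_continuous.
have cg := continuous_min (continuousD ca cb) (continuousD cc cb).
have c1 := continuousM (continuousD cb (continuousM (c0 D) cg)) (c0 (1 + D)^-1).
have c2 := continuousM (continuousB (continuousM (c0 (1 + D)) cg) cb) (c0 D^-1).
have cn : {for x, continuous ((fun x => `|omega x|) : V -> R^o)}.
  by apply: (continuous_comp cw); exact: norm_continuous.
exact: (continuous_max (c0 0) (continuousB (continuous_min c1 c2)
  (continuousM cn (c0 D^-1)))).
Qed.

(** On the path [p q r] the bump equals [beta], so the shear along [p - q + r] is linear on each of
    the two cones and sends [q] to [p + r], a vector of the cone on [p] and [r]. *)
Lemma delta_move D (K : set V) : 0 < D ->
  (forall k x, 0 < k -> K x -> K (k *: x)) ->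
  (forall x, K x -> push D x = 0) ->
  ambient_isotopic (@S3 R `&` (cone2 p q `|` cone2 q r `|` K))
                   (@S3 R `&` (cone2 p r `|` K)).
Proof.
move=> D0 KZ Kpush; pose v := p - q + r.
have pushZ k x : 0 <= k -> push D (k *: x) = k * push D x.
  have cZ i : coord_in i (k *: x) = k * coord_in i x.
    by rewrite /coord_in -scalemxAl mxE.
  by move=> k0; rewrite /push /alpha /beta /gamma /omega !cZ bumpZ.
have push_lip x s : 0 <= s -> push D x - push D (x + s *: v) <= (1 + D)^-1 * s.
  by move=> s0; rewrite /push; have [-> -> -> ->] := coord_shift x s;
    exact: bump_lip.
have k01 : 0 <= (1 + D)^-1 < 1.
  by rewrite invr_ge0 addr_ge0 ?ltW//= invf_lt1 ?addr_gt0// ltrDl.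
have CZ k x : 0 < k -> (cone2 p q `|` cone2 q r `|` K) x ->
    (cone2 p q `|` cone2 q r `|` K) (k *: x).
  by move=> k0 [[?|?]|?]; [left; left|left; right|right];
    [exact: cone2Z|exact: cone2Z|exact: KZ].
have pushl a b : 0 <= a -> 0 <= b -> push D (a *: p + b *: q) = b.
  move=> a0 b0; rewrite /push; have [] := coord_comb a b 0 0.
  by rewrite !scale0r !addr0 => -> -> -> ->; exact: bump_left.
have pushr b c : 0 <= b -> 0 <= c -> push D (b *: q + c *: r) = b.
  move=> b0 c0; rewrite /push; have [] := coord_comb 0 b c 0.
  by rewrite !scale0r add0r !addr0 => -> -> -> ->; rewrite bump_sym;
    exact: bump_left.
have movel a b : (a *: p + b *: q) + b *: v = (a + b) *: p + b *: r.
  by apply/rowP => i; rewrite !mxE; ring.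
have mover b c : (b *: q + c *: r) + b *: v = b *: p + (b + c) *: r.
  by apply/rowP => i; rewrite !mxE; ring.
have := shear_isotopic (@push_continuous D) pushZ k01 push_lip CZ.
congr (ambient_isotopic _ (_ `&` _)); apply/seteqP; split=> [_ [x + <-]|y].
  move=> [[[s [t [s0 t0 ->]]]|[s [t [s0 t0 ->]]]]|Kx].
  - by left; rewrite pushl// movel; exists (s + t), t; rewrite addr_ge0.
  - by left; rewrite pushr// mover; exists s, (s + t); rewrite addr_ge0.
  - by right; rewrite Kpush// scale0r addr0.
move=> [[s [t [s0 t0 ->]]]|Ky]; last first.
  by exists y; [right|rewrite Kpush// scale0r addr0].
(* The ray of [p + r] divides the target into the images of the two old cones. *)
have [st|/ltW st] := leP t s.
  exists ((s - t) *: p + t *: q); last by rewrite pushl ?subr_ge0// movel subrK.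
  by left; left; exists (s - t), t; rewrite subr_ge0.
exists (s *: q + (t - s) *: r); last first.
  by rewrite pushr ?subr_ge0// mover (addrC s) subrK.
by left; right; exists s, (t - s); rewrite subr_ge0.
Qed.

(* The cone on [u], [w] meets that on [p], [q], [r] at most in the ray of [p] or
   in that of [r]. *)
Definition separated (u w : V) : Prop := exists l : V -> R,
  [/\ forall k x y, l (k *: x + y) = k * l x + l y,
      l u <= 0 /\ l w <= 0, 0 <= l p /\ 0 <= l r, 0 < l q & 0 < l p + l r].

(** Each edge allows all sufficiently small widths; for finitely many edges the minimum serves. *)
Lemma push_separated (s : seq (V * V)) :
  (forall e, e \in s -> separated e.1 e.2) ->
  exists2 D0 : R, 0 < D0 & forall D, 0 < D <= D0 ->
    forall e, e \in s -> forall x, cone2 e.1 e.2 x -> push D x = 0.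
Proof.
elim: s => [_|e s IHs seps]; first by exists 1.
have [f fs|D1 D10 D1P] := IHs; first by apply: seps; rewrite inE fs orbT.
have [l [lD [lu lw] [lp lr] lq lpr]] := seps e (mem_head _ _).
have [D2 D20 D2P] := @bump_separated _ _ _ _ (l d) lp lq lr lpr.
exists (Num.min D1 D2); first by rewrite lt_min D10.
move=> D /andP[D0]; rewrite le_min => /andP[DD1 DD2] f;
  rewrite inE => /predU1P[-> {f}|fs] x; last first.
  by move=> fx; apply: D1P fx => //; rewrite D0.
move=> [a [b [a0 b0 xE]]]; rewrite /push; apply: D2P; first by rewrite D0.
have l0 : l 0 = 0.
  by have := lD (-1) 0 0; rewrite scaler0 addr0 mulN1r addNr => ->.
have lZ k y : l (k *: y) = k * l y by rewrite -(addr0 (k *: y)) lD l0 addr0.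
have lA y z : l (y + z) = l y + l z by rewrite -{1}(scale1r y) lD mul1r.
have -> : alpha x * l p + beta x * l q + gamma x * l r + omega x * l d = l x.
  by rewrite [in RHS](frame_decomp x) !lA !lZ.
rewrite xE lA !lZ -oppr_ge0 opprD -!mulrN.
by rewrite addr_ge0// mulr_ge0// oppr_ge0.
Qed.

Lemma delta_move_separated (s : seq (V * V)) :
  (forall e, e \in s -> separated e.1 e.2) ->
  let K := \bigcup_(e in [set` s]) cone2 e.1 e.2 in
  ambient_isotopic (@S3 R `&` (cone2 p q `|` cone2 q r `|` K))
                   (@S3 R `&` (cone2 p r `|` K)).
Proof.
move=> /push_separated[D D0 DP] K; apply: (@delta_move D) => //.
- by move=> k x k0 [e es ex]; exists e => //; exact: cone2Z.
- by move=> x [e es ex]; apply: DP es _ ex; rewrite D0 lexx.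
Qed.

(* Shearing along [p + q + r], under which [min - mean] of the coordinates is
   invariant, flattens the boundary of the cone onto a plane. *)
Lemma triangle_great_circle :
  ambient_isotopic (@S3 R `&` (cone2 p q `|` cone2 q r `|` cone2 r p))
    (@S3 R `&` [set x | alpha x + beta x + gamma x = 0 /\ omega x = 0]).
Proof.
pose v := p + q + r.
pose mn x := Num.min (alpha x) (Num.min (beta x) (gamma x)).
pose phi x := mn x - 3^-1 * (alpha x + beta x + gamma x).
have phic : continuous phi.
  move=> x.
  have c0 k : {for x, continuous ((fun=> k) : V -> R^o)}.
    exact: cst_continuous.
  have ca : {for x, continuous (alpha : V -> R^o)}.
    exact: coord_in_continuous.
  have cb : {for x, continuous (beta : V -> R^o)} by exact: coord_in_continuous.
  have cc : {for x, continuous (gamma : V -> R^o)}.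
    exact: coord_in_continuous.
  exact: (continuousB (continuous_min ca (continuous_min cb cc))
    (continuousM (c0 3^-1) (continuousD (continuousD ca cb) cc))).
have phiZ k x : 0 <= k -> phi (k *: x) = k * phi x.
  have cZ i : coord_in i (k *: x) = k * coord_in i x.
    by rewrite /coord_in -scalemxAl mxE.
  move=> k0; rewrite /phi /mn.
  have [-> -> ->] : [/\ alpha (k *: x) = k * alpha x,
      beta (k *: x) = k * beta x & gamma (k *: x) = k * gamma x].
    by rewrite /alpha /beta /gamma !cZ.
  by rewrite -!(minr_pMr _ _ k0) -!mulrDr mulrBr; congr (_ - _); rewrite mulrCA.
have cshift x s : [/\ alpha (x + s *: v) = alpha x + s,
    beta (x + s *: v) = beta x + s, gamma (x + s *: v) = gamma x + s
    & omega (x + s *: v) = omega x].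
  have := coord_comb (alpha x + s) (beta x + s) (gamma x + s) (omega x) => /=.
  suff -> : (alpha x + s) *: p + (beta x + s) *: q + (gamma x + s) *: r +
    omega x *: d = x + s *: v by [].
  rewrite [in RHS](frame_decomp x).
  move: (alpha x) (beta x) (gamma x) (omega x) => a b c w.
  by apply/rowP => i; rewrite !mxE; ring.
have phi_shift x s : phi (x + s *: v) = phi x.
  rewrite /phi /mn; have [-> -> -> _] := cshift x s.
  by rewrite -!addr_minl; field.
(* As [phi] is constant along [v], the slope bound holds with [kappa = 0]. *)
have k01 : 0 <= (0 : R) < 1 by rewrite lexx ltr01.
have phil x s : 0 <= s -> phi x - phi (x + s *: v) <= 0 * s.
  by rewrite phi_shift subrr mul0r.
have CZ k x : 0 < k -> (cone2 p q `|` cone2 q r `|` cone2 r p) x ->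
    (cone2 p q `|` cone2 q r `|` cone2 r p) (k *: x).
  by move=> k0 [[?|?]|?]; [left; left|left; right|right]; exact: cone2Z.
have := shear_isotopic phic phiZ k01 phil CZ.
congr (ambient_isotopic _ (_ `&` _)); apply/seteqP;
  split=> [_ [x Cx <-]|y [y0 w0]].
  rewrite /=; have [-> -> -> ->] := cshift x (phi x).
  (* The three cones form the boundary of the positive octant, where the least coordinate vanishes;
     [phi] is then minus the mean. *)
  suff [-> mx] : omega x = 0 /\ mn x = 0 by split=> //; rewrite /phi mx; field.
  case: Cx => [[[s [t [s0 t0 xE]]]|[s [t [s0 t0 xE]]]]|[s [t [s0 t0 xE]]]].
  - have := coord_comb s t 0 0; rewrite !scale0r !addr0 -xE /mn =>
    -[-> -> -> ->].
    by split=> //; rewrite (min_r t0) min_r.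
  - have := coord_comb 0 s t 0; rewrite !scale0r add0r !addr0 -xE /mn =>
    -[-> -> -> ->].
    by split=> //; rewrite min_l // le_min s0.
  - have := coord_comb t 0 s 0; rewrite !scale0r !addr0 addrC -xE /mn =>
    -[-> -> -> ->].
    by split=> //; rewrite (min_l s0) min_r.
exists (y - mn y *: v); last first.
  have -> : phi (y - mn y *: v) = mn y.
    by rewrite -scaleNr phi_shift /phi y0 mulr0 subr0.
  by rewrite subrK.
have [ca [cb cc]] : mn y <= alpha y /\ mn y <= beta y /\ mn y <= gamma y.
  by rewrite /mn !ge_min !lexx !orbT.
have -> : y - mn y *: v =
    (alpha y - mn y) *: p + (beta y - mn y) *: q + (gamma y - mn y) *: r.
  move: (mn y) => m; rewrite [in LHS](frame_decomp y) w0 scale0r addr0.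
  by apply/rowP => i; rewrite !mxE; ring.
(* The coordinate attaining the minimum becomes zero and so selects the cone. *)
have : mn y = alpha y \/ mn y = beta y \/ mn y = gamma y.
  by rewrite /mn /Num.min; do !case: ifP; auto.
move=> [<-|[<-|<-]]; rewrite subrr scale0r ?add0r ?addr0.
- by left; right; exists (beta y - mn y), (gamma y - mn y); rewrite !subr_ge0.
- by right; exists (gamma y - mn y), (alpha y - mn y); rewrite !subr_ge0 addrC.
- by left; left; exists (alpha y - mn y), (beta y - mn y); rewrite !subr_ge0.
Qed.

End Frames.

(** ** The moment curve *)

Section MomentCurve.
Variable R : realType.
Local Notation V := 'rV[R]_4.
Implicit Types (t u w a b c : R) (x y : V).

(* The constant coordinate comes last, so that differences of moment vectors
   lie in the hyperplane [x_3 = 0] containing the plane of [unknot]. *)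
Definition moment t : V := \row_(i < 4) nth 0 [:: t; t ^+ 2; t ^+ 3; 1] i.

Definition entry (n : nat) x : R := x ord0 (inord n).

Lemma entry_lin n k x y : entry n (k *: x + y) = k * entry n x + entry n y.
Proof. by rewrite /entry !mxE. Qed.

Lemma entry_moment n t : (n < 4)%N ->
  entry n (moment t) = nth 0 [:: t; t ^+ 2; t ^+ 3; 1] n.
Proof. by move=> n4; rewrite /entry mxE inordK. Qed.

(** The polynomial [(t - a) * (t - b)] as a linear functional: the entries 1, 0 and 3 stand for
    [t ^+ 2], [t] and 1. *)
Definition quadratic a b x : R :=
  entry 1 x - (a + b) * entry 0 x + a * b * entry 3 x.

Definition cubic a b c x : R :=
  entry 2 x - (a + b + c) * entry 1 x + (a * b + b * c + c * a) * entry 0 x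
  - a * b * c * entry 3 x.

Lemma quadratic_lin a b k x y :
  quadratic a b (k *: x + y) = k * quadratic a b x + quadratic a b y.
Proof. by rewrite /quadratic !entry_lin; ring. Qed.

Lemma cubic_lin a b c k x y :
  cubic a b c (k *: x + y) = k * cubic a b c x + cubic a b c y.
Proof. by rewrite /cubic !entry_lin; ring. Qed.

Lemma quadratic_moment a b t : quadratic a b (moment t) = (t - a) * (t - b).
Proof. by rewrite /quadratic !entry_moment//=; ring. Qed.

Lemma cubic_moment a b c t :
  cubic a b c (moment t) = (t - a) * (t - b) * (t - c).
Proof. by rewrite /cubic !entry_moment//=; ring. Qed.

Lemma cubic0 a b c : cubic a b c 0 = 0.
Proof. by rewrite /cubic /entry !mxE; ring. Qed.

(** Lagrange interpolation: the cubic with roots at three of the parameters isolates the coefficient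
    of the fourth. *)
Lemma moment_free (p q r d a b c w : R) : uniq [:: p; q; r; d] ->
  a *: moment p + (b *: moment q + (c *: moment r + (w *: moment d + 0))) = 0 ->
  [/\ a = 0, b = 0, c = 0 & w = 0].
Proof.
rewrite /= !inE !negb_or -!andbA andbT => /and5P[pq pr pd qr /andP[qd rd]] E.
have L i j k : a * ((p - i) * (p - j) * (p - k)) +
    (b * ((q - i) * (q - j) * (q - k)) + (c * ((r - i) * (r - j) * (r - k)) +
     w * ((d - i) * (d - j) * (d - k)))) = 0.
  have := congr1 (cubic i j k) E.
  by rewrite !cubic_lin !cubic_moment cubic0 addr0.
have ns (i j : R) : i != j -> (j == i) = false by move=> /negPf; rewrite eq_sym.
split; [have := L q r d|have := L p r d|have := L p q d|have := L p q r];
  rewrite !subrr !(mulr0, mul0r, addr0, add0r) => /eqP;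
  rewrite !mulf_eq0 !subr_eq0 ?(negPf pq) ?(negPf pr) ?(negPf pd) ?(negPf qr)
    ?(negPf qd) ?(negPf rd) ?(ns _ _ pq) ?(ns _ _ pr) ?(ns _ _ pd) ?(ns _ _ qr)
    ?(ns _ _ qd) ?(ns _ _ rd) !orbF => /eqP; exact.
Qed.

Lemma frame_moment_unit (p q r d : R) : uniq [:: p; q; r; d] ->
  frame (moment p) (moment q) (moment r) (moment d) \in unitmx.
Proof.
set F := frame _ _ _ _ => U; rewrite -row_free_unit -kermx_eq0.
apply/eqP/row_matrixP => i; rewrite row0; set x := row i _.
have : x *m F = 0 by rewrite -row_mul mulmx_ker row0.
rewrite mulmx_sum_row 4!big_ord_recl big_ord0 !rowK /=.
move=> /(moment_free U)[x0 x1 x2 x3]; apply/rowP => j; rewrite [RHS]mxE.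
case: j => -[|[|[|[|//]]]] j4.
- by rewrite -[RHS]x0; congr (x _ _); exact/val_inj.
- by rewrite -[RHS]x1; congr (x _ _); exact/val_inj.
- by rewrite -[RHS]x2; congr (x _ _); exact/val_inj.
- by rewrite -[RHS]x3; congr (x _ _); exact/val_inj.
Qed.

(* The remaining linear shear replaces the coordinate [x_2] by the cubic
   functional vanishing at [p], [q] and [r]. *)
Lemma triangle_unknot (p q r d : R) : uniq [:: p; q; r; d] ->
  ambient_isotopic (@S3 R `&` (cone2 (moment p) (moment q) `|`
    cone2 (moment q) (moment r) `|` cone2 (moment r) (moment p))) (@unknot R).
Proof.
move=> U; have FU := frame_moment_unit U.
apply: (ambient_isotopic_trans (triangle_great_circle FU)).
pose e2 : V := delta_mx ord0 (inord 2).
have e2E n : (n < 4)%N -> entry n e2 = (n == 2)%:R.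
  by move=> n4; rewrite /entry mxE eqxx -val_eqE /= !inordK.
(* The cubic has leading coefficient 1, so [phi] does not involve the coordinate along [e2]. *)
pose phi x := cubic p q r x - entry 2 x.
have phi_lin k x y : phi (k *: x + y) = k * phi x + phi y.
  by rewrite /phi cubic_lin entry_lin; ring.
have phic : continuous phi.
  move=> x.
  have c0 k : {for x, continuous ((fun=> k) : V -> R^o)}.
    exact: cst_continuous.
  have ce n : {for x, continuous (entry n : V -> R^o)}.
    exact: coord_continuous.
  apply: (@continuousB R R^o V (cubic p q r) (entry 2)) => //.
  exact: (continuousB (continuousD (continuousB (ce 2)
    (continuousM (c0 _) (ce 1))) (continuousM (c0 _) (ce 0)))
    (continuousM (c0 _) (ce 3))).
have phi0 : phi 0 = 0 by rewrite /phi cubic0 /entry mxE subrr.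
have phiZ k x : 0 <= k -> phi (k *: x) = k * phi x.
  by move=> _; rewrite -(addr0 (k *: x)) phi_lin phi0 addr0.
have phi_e2 : phi e2 = 0 by rewrite /phi /cubic !e2E//=; ring.
have phi_shift x s : phi (x + s *: e2) = phi x.
  by rewrite addrC phi_lin phi_e2 mulr0 add0r.
have k01 : 0 <= (0 : R) < 1 by rewrite lexx ltr01.
have phil x s : 0 <= s -> phi x - phi (x + s *: e2) <= 0 * s.
  by rewrite phi_shift subrr mul0r.
set P := [set x | _].
have PZ k x : 0 < k -> P x -> P (k *: x).
  have cZ i : coord_in (moment p) (moment q) (moment r) (moment d) i (k *: x) =
      k * coord_in (moment p) (moment q) (moment r) (moment d) i x.
    by rewrite /coord_in -scalemxAl mxE.
  rewrite /P /= /alpha /beta /gamma /omega !cZ => _ [s0 ->].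
  by rewrite -!mulrDr s0 !mulr0.
have := shear_isotopic phic phiZ k01 phil PZ.
congr (ambient_isotopic _ _).
(* In frame coordinates the cubic is a nonzero multiple of [omega], and [entry 3] is the sum of all
   four coordinates. *)
have PE x : P x <-> cubic p q r x = 0 /\ entry 3 x = 0.
  rewrite {2 3}(frame_decomp FU x) -(addr0 (_ + _ *: moment d)) -!addrA.
  rewrite !cubic_lin !cubic_moment cubic0 !entry_lin !entry_moment//=.
  have -> : entry 3 (0 : V) = 0 by rewrite /entry mxE.
  rewrite !subrr !(mulr0, mul0r, mulr1, addr0, add0r) /P /= !addrA.
  move: U; rewrite /= !inE !negb_or -!andbA andbT =>
    /and5P[_ _ pd _ /andP[qd rd]].
  split=> [[-> ->]|[/eqP + E3]]; first by rewrite mul0r addr0.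
  rewrite !mulf_eq0 !subr_eq0 ![d == _]eq_sym (negPf pd) (negPf qd) (negPf rd)
    !orbF.
  by move=> /eqP w0; move: E3; rewrite w0 addr0.
have shiftE x : entry 3 (x + phi x *: e2) = entry 3 x /\
    entry 2 (x + phi x *: e2) = cubic p q r x.
  rewrite !(addrC x) !entry_lin !e2E//=; split; rewrite /phi; ring.
have unknotE y : (forall i : 'I_4, (2 <= i)%N -> y ord0 i = 0) <->
    entry 2 y = 0 /\ entry 3 y = 0.
  split=> [y0|[y2 y3] [[|[|[|[|//]]]] i4] // _].
  - by rewrite /entry !y0 ?inordK.
  - by rewrite -[RHS]y2 /entry; congr (y _ _); apply/val_inj; rewrite /= inordK.
  - by rewrite -[RHS]y3 /entry; congr (y _ _); apply/val_inj; rewrite /= inordK.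
apply/seteqP; split=> y [y3 Hy]; split=> //.
  case: Hy => x /PE[cx x3] <-; apply/unknotE; have [-> ->] := shiftE x.
  by split.
move/unknotE: Hy => [y2 yy3]; exists (y - phi y *: e2); last first.
  by rewrite -scaleNr phi_shift scaleNr subrK.
apply/PE; have := shiftE (y - phi y *: e2).
have -> : phi (y - phi y *: e2) = phi y by rewrite -scaleNr phi_shift.
by rewrite subrK y2 yy3 => -[<- <-].
Qed.

End MomentCurve.

(** * Polygons with vertices on the moment curve *)

Section MomentPolygons.
Variable R : realType.
Local Notation V := 'rV[R]_4.

Definition vertex (n : nat) : V := moment n%:R.

Definition edges (T : eqType) (c : seq T) : seq (T * T) := zip c (rot 1 c).

Lemma mem_edges (T : eqType) (c : seq T) e : uniq c ->
  (e \in edges c) = (e.1 \in c) && (e.2 == next c e.1).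
Proof.
move=> uc; have -> : edges c = [seq (x, next c x) | x <- c].
  case: c uc => [//|p s] uc; rewrite /edges rot1_cons.
  apply: (@eq_from_nth _ (p, p)) => [|i].
    by rewrite size_zip size_map size_rcons minnn.
  rewrite size_zip size_rcons minnn => i_lt.
  (* The default value [p] makes the last vertex wrap around to the first. *)
  rewrite nth_zip ?size_rcons// (nth_map p)// next_nth mem_nth// index_uniq//.
  by rewrite nth_rcons if_same; case: ltnP => // si; rewrite (nth_default p si).
apply/mapP/andP => [[x xc ->]|[xc /eqP e2]]; first by rewrite xc eqxx.
by exists e.1 => //; rewrite -e2; case: e {xc e2}.
Qed.

Lemma bigcup_cons (T : eqType) (a : T) s (F : T -> set V) :
  \bigcup_(e in [set` a :: s]) F e = F a `|` \bigcup_(e in [set` s]) F e.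
Proof.
apply/seteqP; split=> x [].
- by move=> e /=; rewrite inE => /predU1P[->|es] ex; [left|right; exists e].
- by exists a => //=; rewrite mem_head.
- by move=> [e /= es ex]; exists e => //=; rewrite inE es orbT.
Qed.

(** The cone over the spherical polygon, so that shears apply to it directly. *)
Definition polygon (c : seq nat) : set V :=
  \bigcup_(e in [set` edges c]) cone2 (vertex e.1) (vertex e.2).

Lemma polygon_rot k c : uniq c -> polygon (rot k c) = polygon c.
Proof.
move=> uc; rewrite /polygon.
suff -> : [set` edges (rot k c)] = [set` edges c] by [].
by apply/seteqP; split=> e /=; rewrite !mem_edges ?rot_uniq// mem_rot next_rot.
Qed.

Lemma polygon_cons p q s :
  polygon (p :: q :: s) = cone2 (vertex p) (vertex q) `|`
    \bigcup_(e in [set` zip (q :: s) (rcons s p)])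
      cone2 (vertex e.1) (vertex e.2).
Proof. by rewrite /polygon /edges rot1_cons /= bigcup_cons. Qed.

Lemma pathE (e : rel nat) p r s :
  path e r (rcons s p) = all (fun f => e f.1 f.2) (zip (r :: s) (rcons s p)).
Proof. by elim: s r => [|y s IHs] r //=; rewrite IHs. Qed.

(** Each alternative supplies a polynomial that vanishes at [u] and [w] and is positive at those of
    [p], [q], [r] that differ from both. *)
Lemma unobstructed_separated p q r u w : unobstructed p q r u w ->
  separated (vertex p) (vertex q) (vertex r) (vertex u) (vertex w).
Proof.
move=> /and4P[qu qw pr ob].
have [l [l_lin lu lw lT]] : exists l : V -> R,
    [/\ forall k x y, l (k *: x + y) = k * l x + l y,
        l (vertex u) = 0, l (vertex w) = 0 &
        forall x, x \in [:: p; q; r] -> x != u -> x != w -> 0 < l (vertex x)].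
  have cub a b c : forall k x y, - cubic a b c (k *: x + y) =
      k * - cubic a b c x + - cubic a b c y.
    by move=> k x y; rewrite cubic_lin mulrN opprD.
  have sq (x y : nat) : x != y -> 0 < (x%:R - y%:R) * (x%:R - y%:R) :> R.
    by move=> xy; rewrite -expr2 exprn_even_gt0//= subr_eq0 eqr_nat.
  have lt (x y : nat) : (x <= y)%N -> y != x -> 0 < y%:R - x%:R :> R.
    by move=> xy yx; rewrite subr_gt0 ltr_nat ltn_neqAle eq_sym yx.
  case/or4P: ob => [/allP H|/allP H|/allP H|/orP[/allP H|/allP H]].
  - exists (quadratic u%:R w%:R); split; rewrite /vertex ?quadratic_moment
    ?subrr ?mulr0 ?mul0r//.
      exact: quadratic_lin.
    move=> x xT xu xw; rewrite quadratic_moment.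
    case/orP: (H x xT) => /andP[a b].
      by rewrite -mulrNN !opprB mulr_gt0// lt// eq_sym.
    by rewrite mulr_gt0// lt.
  - exists (cubic u%:R w%:R w%:R); split; rewrite /vertex ?cubic_moment ?subrr
    ?mulr0 ?mul0r//.
      exact: cubic_lin.
    by move=> x xT xu xw; rewrite cubic_moment -mulrA mulr_gt0 ?sq// lt// H.
  - exists (fun x => - cubic u%:R w%:R w%:R x); split;
    rewrite /vertex ?cubic_moment ?subrr ?mulr0 ?mul0r ?oppr0//.
      exact: cub.
    move=> x xT xu xw; rewrite cubic_moment -mulrA -mulNr opprB.
    by rewrite mulr_gt0 ?sq//; apply: lt; [exact: H|rewrite eq_sym].
  - exists (cubic w%:R u%:R u%:R); split; rewrite /vertex ?cubic_moment ?subrr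
    ?mulr0 ?mul0r//.
      exact: cubic_lin.
    by move=> x xT xu xw; rewrite cubic_moment -mulrA mulr_gt0 ?sq// lt// H.
  - exists (fun x => - cubic w%:R u%:R u%:R x); split;
    rewrite /vertex ?cubic_moment ?subrr ?mulr0 ?mul0r ?oppr0//.
      exact: cub.
    move=> x xT xu xw; rewrite cubic_moment -mulrA -mulNr opprB.
    by rewrite mulr_gt0 ?sq//; apply: lt; [exact: H|rewrite eq_sym].
have lT0 x : x \in [:: p; q; r] -> 0 <= l (vertex x).
  move=> xT; have [->|xu] := eqVneq x u; first by rewrite lu.
  have [->|xw] := eqVneq x w; first by rewrite lw.
  by rewrite ltW// lT.
have pT : p \in [:: p; q; r] by rewrite !inE eqxx.
have qT : q \in [:: p; q; r] by rewrite !inE eqxx orbT.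
have rT : r \in [:: p; q; r] by rewrite !inE eqxx !orbT.
exists l; split=> //; first by rewrite lu lw.
- by rewrite !lT0.
- exact: lT.
(* At least one of [p], [r] is not an end of the edge, which makes the sum strictly positive. *)
- move: pr; rewrite !inE negb_and !negb_or => /orP[] /andP[xu xw].
    by rewrite ltr_wpDr ?lT0// lT.
  by rewrite ltr_wpDl ?lT0// lT.
Qed.

(** The parameter [p + q + r + 1], larger than the other three, completes a frame. *)
Lemma uniq_vertex (p q r : nat) : uniq [:: p; q; r] ->
  uniq [:: p%:R; q%:R; r%:R; (p + q + r).+1%:R : R].
Proof.
move=> U; have -> : [:: p%:R; q%:R; r%:R; (p + q + r).+1%:R : R] =
  map (fun n : nat => n%:R) [:: p; q; r; (p + q + r).+1] by [].
rewrite map_inj_uniq; last by move=> m n /eqP; rewrite eqr_nat => /eqP.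
rewrite -[X in uniq X]/(rcons [:: p; q; r] _) rcons_uniq U andbT !inE.
by apply/negP => /or3P[] /eqP; lia.
Qed.

Lemma removable_isotopic c : uniq c -> removable c ->
  ambient_isotopic (@S3 R `&` polygon c)
    (@S3 R `&` polygon (head 0%N c :: drop 2 c)).
Proof.
case: c => [//|p [//|q [//|r s]]] U /=; rewrite pathE => /allP free.
have FU : frame (vertex p) (vertex q) (vertex r) (moment (p + q + r).+1%:R)
    \in unitmx.
  apply/frame_moment_unit/uniq_vertex.
  by move: U; rewrite -[X in uniq X]/([:: p; q; r] ++ s) cat_uniq => /andP[].
rewrite /= !polygon_cons.
rewrite [zip (q :: _) _]/= bigcup_cons setUA /=.
(* The edges from [r] back to [p], common to both polygons. *)
set E := zip _ _.
have := @delta_move_separated R _ _ _ _ FU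
  [seq (vertex e.1, vertex e.2) | e <- E].
have -> : \bigcup_(e in [set` [seq (vertex e.1, vertex e.2) | e <- E]])
    cone2 e.1 e.2 = \bigcup_(e in [set` E]) cone2 (vertex e.1) (vertex e.2).
  apply/seteqP; split=> x [e /= eE ex]; last first.
    by exists (vertex e.1, vertex e.2) => //=; apply/mapP; exists e.
  by case/mapP: eE ex => f fE -> ex; exists f.
apply=> e /mapP[f fE ->] /=.
exact: unobstructed_separated (free f fE).
Qed.

(** A removal is an isotopy, a rotation leaves the polygon unchanged, and the process stops at a
    triangle. *)
Lemma shrinkable_unknot n c : uniq c -> (2 < size c)%N -> shrinkable n c ->
  ambient_isotopic (@S3 R `&` polygon c) (@unknot R).
Proof.
elim: n c => [//|n IHn] c uc c3 /=.
case: leqP => c3'.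
  case: c uc c3 c3' => [//|p [//|q [//|r [|//]]]] uc _ _ _.
  rewrite polygon_cons /= !bigcup_cons /= set_nil bigcup_set0 setU0 setUA.
  by apply: triangle_unknot; exact: (uniq_vertex uc).
case: ifP => [rc sc|_ sc]; last first.
  by rewrite -(polygon_rot 1 uc); apply: IHn => //; rewrite ?rot_uniq ?size_rot.
apply: ambient_isotopic_trans (removable_isotopic uc rc) _.
apply: IHn sc.
  case: c uc {c3 c3' rc} => [//|p [//|q s]] /= /andP[ps /andP[_ us]].
  by rewrite drop0 us andbT; apply: contra ps; rewrite inE => ->; rewrite orbT.
by case: c c3 c3' {uc rc} => [//|p [//|q s]] /=; rewrite drop0.
Qed.

End MomentPolygons.

(** ** The straight embedding *)

Section StraightEmbedding.
Variables (R : realType) (V : finType) (e : rel V).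
Hypothesis e_tour : tournament e.
Variable lab : V -> nat.
Hypothesis lab_inj : injective lab.
Implicit Types (x y z : V) (t : R).

Definition chord x y t : 'rV[R]_4 :=
  (1 - t) *: vertex R (lab x) + t *: vertex R (lab y).

Lemma lab_eq x y : ((lab x)%:R == (lab y)%:R :> R) = (x == y).
Proof. by rewrite eqr_nat (inj_eq lab_inj). Qed.

Lemma chord_functional (l : 'rV[R]_4 -> R) x y t :
  (forall k u v, l (k *: u + v) = k * l u + l v) -> l 0 = 0 ->
  l (chord x y t) = (1 - t) * l (vertex R (lab x)) + t * l (vertex R (lab y)).
Proof.
by move=> l_lin l0; rewrite /chord l_lin -(addr0 (t *: _)) l_lin l0 addr0.
Qed.

Lemma entry_chord x y t n : (n < 4)%N -> entry n (chord x y t) =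
  (1 - t) * entry n (vertex R (lab x)) + t * entry n (vertex R (lab y)).
Proof.
by move=> n4; apply: chord_functional; [exact: entry_lin|rewrite /entry mxE].
Qed.

Lemma entry3_chord x y t : entry 3 (chord x y t) = 1.
Proof. by rewrite entry_chord// !entry_moment//=; ring. Qed.

Lemma chord_neq0 x y t : chord x y t != 0.
Proof.
apply/eqP => /(congr1 (entry 3)); rewrite entry3_chord /entry mxE => /eqP.
by rewrite oner_eq0.
Qed.

Lemma chord0 x y : chord x y 0 = vertex R (lab x).
Proof. by rewrite /chord subr0 scale1r scale0r addr0. Qed.

Lemma chord1 x y : chord x y 1 = vertex R (lab y).
Proof. by rewrite /chord subrr scale0r scale1r add0r. Qed.

(** All chords lie in the affine hyperplane [entry 3 = 1], which meets a ray from the origin at most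
    once. *)
Lemma radial_chord_inj x y t x' y' t' :
  radial (chord x y t) = radial (chord x' y' t') ->
  chord x y t = chord x' y' t'.
Proof.
move=> /radial_eq[||k k0 E]; rewrite ?chord_neq0//.
move: (congr1 (entry 3) E).
rewrite -(addr0 (k *: _)) (entry_lin 3 k) !entry3_chord.
by rewrite {1}/entry mxE addr0 mulr1 => k1; rewrite E -k1 scale1r.
Qed.

Lemma chord_quadratic a b x y t : quadratic a b (chord x y t) =
  (1 - t) * (((lab x)%:R - a) * ((lab x)%:R - b)) +
  t * (((lab y)%:R - a) * ((lab y)%:R - b)).
Proof.
rewrite chord_functional ?quadratic_moment//; first exact: quadratic_lin.
by rewrite /quadratic /entry !mxE; ring.
Qed.

Lemma chord_cubic a b c x y t : cubic a b c (chord x y t) =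
  (1 - t) * (((lab x)%:R - a) * ((lab x)%:R - b) * ((lab x)%:R - c)) +
  t * (((lab y)%:R - a) * ((lab y)%:R - b) * ((lab y)%:R - c)).
Proof.
rewrite chord_functional ?cubic_moment//; first exact: cubic_lin.
exact: cubic0.
Qed.

Lemma chord_param_inj x y t t' : x != y -> chord x y t = chord x y t' -> t = t'.
Proof.
move=> xy /(congr1 (entry 0)); rewrite !entry_chord// !entry_moment//= => E.
have : (t - t') * ((lab y)%:R - (lab x)%:R) = 0 by lra.
move=> /eqP; rewrite mulf_eq0 !subr_eq0 lab_eq [y == x]eq_sym (negPf xy) orbF.
by move/eqP.
Qed.

Lemma edge_neq x y : e x y -> x != y.
Proof.
by move=> xy; apply: contraTneq xy => ->; rewrite (tournament_irr e_tour).
Qed.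

(** The quadratic with roots at the ends of the chord vanishes along it, so [z] would be an end and
    [t] would be 0 or 1. *)
Lemma chord_vertex x y z t : e x y -> t \in `]0, 1[ ->
  chord x y t <> vertex R (lab z).
Proof.
move=> /edge_neq xy /[!in_itv]/= /andP[t0 t1]; rewrite -(chord0 z z) => E.
have := congr1 (quadratic (lab x)%:R (lab y)%:R) E.
rewrite !chord_quadratic !subrr !(mulr0, mul0r, addr0, add0r) subr0 mul1r =>
  /esym/eqP.
rewrite mulf_eq0 !subr_eq0 !lab_eq => /orP[] /eqP zE.
  move: E; rewrite chord0 zE -(chord0 x y) => /(chord_param_inj xy)/eqP.
  by rewrite gt_eqF.
by move: E; rewrite chord0 zE -(chord1 x y) => /(chord_param_inj xy)/eqP;
  rewrite lt_eqF.
Qed.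

(** The cubic with roots at [x], [y], [x'] vanishes on the first chord, and on the second it is [t']
    times its value at [y']; hence [y'] is [x] or [y]. The same holds for [x']. *)
Lemma chord_inj x y x' y' t t' : e x y -> e x' y' ->
  t \in `]0, 1[ -> t' \in `]0, 1[ ->
  chord x y t = chord x' y' t' -> [/\ x = x', y = y' & t = t'].
Proof.
move=> exy exy' /[!in_itv]/= /andP[t0 t1] /andP[t'0 t'1] E.
have xy := edge_neq exy; have xy' := edge_neq exy'.
have t'n : (t' == 0) = false by rewrite gt_eqF.
have t'n1 : (1 - t' == 0) = false by rewrite subr_eq0 gt_eqF.
have /orP y'E : (y' == x) || (y' == y).
  have := congr1 (cubic (lab x)%:R (lab y)%:R (lab x')%:R) E.
  rewrite !chord_cubic !subrr !(mulr0, mul0r, addr0, add0r) => /esym/eqP.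
  by rewrite !mulf_eq0 t'n !subr_eq0 !lab_eq [y' == x']eq_sym (negPf xy') orbF.
have /orP x'E : (x' == x) || (x' == y).
  have := congr1 (cubic (lab x)%:R (lab y)%:R (lab y')%:R) E.
  rewrite !chord_cubic !subrr !(mulr0, mul0r, addr0, add0r) => /esym/eqP.
  by rewrite !mulf_eq0 t'n1 !subr_eq0 !lab_eq (negPf xy') orbF.
case: x'E y'E => /eqP x'E [] /eqP y'E; move: xy' exy' E;
  rewrite x'E y'E ?eqxx//.
- by move=> _ _ /(chord_param_inj xy).
(* The second chord would be the first one reversed. *)
- by move=> _; rewrite (tournament_asym e_tour exy).
Qed.

Lemma chord_continuous x y : continuous (chord x y).
Proof.
move=> t.
have c0 (v : 'rV[R]_4) : {for t, continuous ((fun=> v) : R -> 'rV[R]_4)}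
  by exact: cst_continuous.
have ci : {for t, continuous (id : R -> R)} by [].
have c1 : {for t, continuous ((fun t => 1 - t) : R -> R)}.
  by apply: (@continuousB R R^o R (fun=> 1) id) => //; exact: cst_continuous.
exact: (continuousD (continuousZ c1 (c0 _)) (continuousZ ci (c0 _))).
Qed.

Definition straight_embedding : embedding R e.
Proof.
refine (@Embedding R V e (fun x => radial (vertex R (lab x)))
  (fun x y t => radial (chord x y t)) _ _ _ _ _ _ _ _).
- by move=> x; rewrite -(chord0 x x); apply: radial_S3; exact: chord_neq0.
- by move=> x y t _ _; apply: radial_S3; exact: chord_neq0.
- move=> x y _; apply: continuous_subspaceT => t.
  apply: (@continuous_comp _ _ _ (chord x y) (@radial R)).
    exact: chord_continuous.
  by apply: radial_continuous; exact: chord_neq0.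
- by move=> x y _; rewrite chord0.
- by move=> x y _; rewrite chord1.
- move=> x y; rewrite -(chord0 x x) -(chord0 y y) => /radial_chord_inj.
  move/(congr1 (entry 0)); rewrite !chord0 !entry_moment//= => /eqP.
  by rewrite lab_eq => /eqP.
- move=> x y z t xy t01; rewrite -(chord0 z z) => /radial_chord_inj.
  by rewrite chord0; exact: chord_vertex.
- move=> x y x' y' t t' xy xy' t01 t'01 /radial_chord_inj.
  exact: chord_inj.
Defined.

Lemma chord_image x y : (fun t => radial (chord x y t)) @` `[0, 1] =
  @S3 R `&` cone2 (vertex R (lab x)) (vertex R (lab y)).
Proof.
apply/seteqP; split=> [_ [t + <-]|z [z3 [s [t [s0 t0 zE]]]]].
  rewrite /= in_itv/= => /andP[t0 t1].
  split; first by apply: radial_S3; exact: chord_neq0.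
  have n0 : 0 <= (norm2 (chord x y t))^-1 by rewrite invr_ge0 sqrtr_ge0.
  exists ((norm2 (chord x y t))^-1 * (1 - t)), ((norm2 (chord x y t))^-1 * t).
  by rewrite !mulr_ge0 ?subr_ge0//; split=> //;
    rewrite /radial {2}/chord scalerDr !scalerA.
have st0 : 0 < s + t.
  rewrite lt0r addr_ge0// andbT; apply: contra (S3_neq0 z3) => st.
  move: st; rewrite paddr_eq0// => /andP[/eqP s00 /eqP t00].
  by rewrite zE s00 t00 !scale0r addr0.
(* Dividing by [s + t] turns the conic combination into a convex one. *)
exists (t / (s + t)).
  by rewrite /= in_itv/= divr_ge0 ?(ltW st0)//= ler_pdivrMr// mul1r lerDr.
have -> : chord x y (t / (s + t)) = (s + t)^-1 *: z.
  rewrite zE scalerDr !scalerA /chord; congr (_ *: _ + _ *: _);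
    last by rewrite mulrC.
  by field; rewrite gt_eqF.
by rewrite radialZ ?invr_gt0// radial_id.
Qed.

Lemma straight_embedding_tame : tame (emb_image straight_embedding).
Proof.
exists (emb_image straight_embedding); last exact: ambient_isotopic_refl.
(* The degenerate arcs from a vertex to itself account for the vertices. *)
exists [seq (vertex R (lab xy.1), vertex R (lab xy.2)) |
  xy <- enum {: V * V} & e xy.1 xy.2 || (xy.1 == xy.2)].
have loop x : radial (vertex R (lab x)) = radial (chord x x 0)
  by rewrite chord0.
apply/seteqP; split=> [z|z].
  move=> [[x _ <-]|[[x y] /= xy]].
    exists (vertex R (lab x), vertex R (lab x)).
      by apply/mapP; exists (x, x); rewrite // mem_filter /= eqxx orbT mem_enum.
    rewrite great_arcE -chord_image; exists 0; last exact/esym/loop.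
    by rewrite /= in_itv/= lexx ler01.
  move=> zxy; exists (vertex R (lab x), vertex R (lab y)); last first.
    by rewrite great_arcE -chord_image; exact: zxy.
  by apply/mapP; exists (x, y); rewrite // mem_filter /= xy mem_enum.
move=> [_ /= /mapP[[x y] /[!mem_filter] /andP[/= xy _] -> /=]].
rewrite great_arcE -chord_image; case/orP: xy => [xy|/eqP <-] zxy.
  by right; exists (x, y).
case: zxy => t _ <-; left; exists x => //=; congr radial.
by rewrite /chord -scalerDl subrK scale1r.
Qed.

Lemma straight_cycle_image (c : seq V) : uniq c ->
  cycle_image straight_embedding c = @S3 R `&` polygon (map lab c).
Proof.
move=> uc; have ulc : uniq (map lab c) by rewrite map_inj_uniq.
apply/seteqP; split=> [z [x /= xc]|z [z3 [[u v] /=]]].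
  move=> zx; have [z3 {}zx] :
      (@S3 R `&` cone2 (vertex R (lab x)) (vertex R (lab (next c x)))) z.
    by rewrite -chord_image; exact: zx.
  split=> //.
  exists (lab x, lab (next c x)) => //=.
  by rewrite mem_edges//= (mem_map lab_inj) xc next_map/=.
rewrite mem_edges//= => /andP[/mapP[x xc ->] /eqP ->]; rewrite next_map// => zx.
exists x => //; suff : (@S3 R `&` cone2 (vertex R (lab x))
    (vertex R (lab (next c x)))) z by rewrite -chord_image.
by [].
Qed.

End StraightEmbedding.

Local Close Scope ring_scope.
Local Close Scope classical_set_scope.

Theorem proposition3p2 (R : realType) (V : finType) (e : rel V)
    (hV : #|V| = 8) (he : tournament e) :
  ~ intrinsically_knotted_digraph R e.
Proof.
have [lab [E [[lab_inj lab8 eE] [Eb E1 E2]]]] := tournament_labeling he hV.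
move=> /(_ (straight_embedding R he lab_inj)).
move=> /(_ (straight_embedding_tame _ _ _)) [c /and3P[c0 ec uc]]; apply.
have ulc : uniq (map lab c) by rewrite map_inj_uniq.
(* Directed cycles of length 1 or 2 contradict irreflexivity or asymmetry. *)
have c3 : (2 < size c)%N.
  case: c c0 ec uc {ulc} => [//|x [|y [|//]]] _ /=.
    by rewrite (tournament_irr he).
  by case/and3P => xy yx _; rewrite (tournament_asym he xy) in yx.
have Ec : cycle E (map lab c).
  by rewrite cycle_map; rewrite (@eq_cycle _ _ e)// => x y; rewrite /= eE.
have [||k sk] := shrinkable_cycle ulc _ _ Ec Eb E1 E2; rewrite ?size_map//.
  by rewrite all_map; apply/allP => x _ /=; exact: lab8.
rewrite straight_cycle_image// -(polygon_rot R k ulc).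
by apply: shrinkable_unknot sk; rewrite ?rot_uniq ?size_rot ?size_map.
Qed.
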